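(* There is a unique $4$-dimensional solvable subalgebra in $\mathfrak{so}(4,\mathbb{C})$, up to inner automorphism, namely $$M_8^1=\langle x_1,\ x_2,\ h_1,\ h_2\rangle,$$ which is isomorphic to the Lie algebra $M_8$.
   Context: $M_8$ is the $4$-dimensional complex Lie algebra with basis $z_1,z_2,z_3,z_4$ whose only nonzero brackets (up to antisymmetry) are $[z_1,z_2]=z_2$ and $[z_3,z_4]=z_4$. $\mathfrak{so}(4,\mathbb{C})\cong\mathfrak{sl}(2,\mathbb{C})\oplus\mathfrak{sl}(2,\mathbb{C})$ is realized as the Lie algebra of $4\times4$ complex block diagonal matrices with two traceless $2\times 2$ diagonal blocks. With $E_{ij}$ the $4\times 4$ matrix units, its Chevalley basis is $x_1=E_{12}$, $y_1=E_{21}$, $h_1=E_{11}-E_{22}$, $x_2=E_{34}$, $y_2=E_{43}$, $h_2=E_{33}-E_{44}$. The notation $\langle\cdots\rangle$ denotes complex linear span. The inner automorphisms of $\mathfrak{so}(4,\mathbb{C})$ are the maps $X\mapsto AXA^{-1}$ with $A\in SL(2,\mathbb{C})\times SL(2,\mathbb{C})$ (block diagonal $4\times4$ matrices with both $2\times2$ blocks of determinant $1$). Two subalgebras $S,S'$ are equivalent (up to inner automorphism), written $S\sim S'$, if $\psi(S)=S'$ for some inner automorphism $\psi$ of $\mathfrak{so}(4,\mathbb{C})$. *)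

(* Defs.v *)
From HB Require Import structures.
From mathcomp Require Import all_boot all_order all_algebra.
From mathcomp Require Import reals.
From mathcomp Require Import complex.
From mathcomp Require Import ring.

Set Implicit Arguments.
Unset Strict Implicit.
Unset Printing Implicit Defensive.

Import GRing.Theory.
Local Open Scope ring_scope.

HB.mixin Record Vector_isLieAlgebra (F : fieldType) L & Vector F L := {
  lie : L -> L -> L;
  lieDZl : forall (a : F) (x y z : L), lie (a *: x + y) z = a *: lie x z + lie y z;
  lieDZr : forall (a : F) (x y z : L), lie x (a *: y + z) = a *: lie x y + lie x z;
  liexx : forall x : L, lie x x = 0;
  lie_jacobi : forall x y z : L,
    lie x (lie y z) + lie y (lie z x) + lie z (lie x y) = 0
}.

#[short(type="lieAlgType")]
HB.structure Definition LieAlgebra (F : fieldType) :=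
  { L of Vector_isLieAlgebra F L & Vector F L }.

Definition lie_isomorphic (F : fieldType) (L L' : lieAlgType F) : Prop :=
  exists f : {linear L -> L'}, bijective f /\ {morph f : x y / lie x y}.

Section Subalgebra.
Context {F : fieldType} {L : lieAlgType F}.

Definition lie_closed (S : {vspace L}) : Prop :=
  forall x y : L, x \in S -> y \in S -> lie x y \in S.

Record subalg := Subalg {
  subalg_space :> {vspace L};
  subalg_closed : lie_closed subalg_space
}.

(* By bilinearity, brackets of basis elements span the same subspace as all
   brackets; see [lie_prodP]. *)
Definition lie_prod (U V : {vspace L}) : {vspace L} :=
  <<[seq lie x y | x <- vbasis U, y <- vbasis V]>>%VS.

Fixpoint derived_series (S : {vspace L}) (n : nat) : {vspace L} :=
  if n is m.+1 then lie_prod (derived_series S m) (derived_series S m) else S.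

Definition lie_solvable (S : {vspace L}) : Prop :=
  exists n, derived_series S n = 0%VS.

Lemma lie0l (y : L) : lie 0 y = 0.
Proof. by have := lieDZl (-1) 0 0 y; rewrite scaler0 addr0 scaleN1r addNr. Qed.

Lemma lie0r (x : L) : lie x 0 = 0.
Proof. by have := lieDZr (-1) x 0 0; rewrite scaler0 addr0 scaleN1r addNr. Qed.

Lemma lie_suml n (a : 'I_n -> F) (x : 'I_n -> L) y :
  lie (\sum_i a i *: x i) y = \sum_i a i *: lie (x i) y.
Proof.
elim/big_rec2: _ => [|i u v _ <-]; first exact: lie0l.
by rewrite lieDZl.
Qed.

Lemma lie_sumr n (a : 'I_n -> F) (x : 'I_n -> L) y :
  lie y (\sum_i a i *: x i) = \sum_i a i *: lie y (x i).
Proof.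
elim/big_rec2: _ => [|i u v _ <-]; first exact: lie0r.
by rewrite lieDZr.
Qed.

Lemma lie_prodP (U V W : {vspace L}) :
  (forall x y, x \in U -> y \in V -> lie x y \in W) <-> (lie_prod U V <= W)%VS.
Proof.
split=> [sW | /span_subvP sW x y xU yV].
  apply/span_subvP=> _ /allpairsP[[x y] /= [xU yV ->]].
  by apply: sW; apply: vbasis_mem.
rewrite (coord_vbasis xU) (coord_vbasis yV) lie_suml.
apply: memv_suml => i _; apply: memvZ; rewrite lie_sumr.
apply: memv_suml => j _; apply: memvZ; apply: sW.
by apply: allpairs_f; apply: mem_nth; rewrite size_tuple.
Qed.

Lemma lie_closed_span (s : seq L) :
  {in s &, forall x y, lie x y \in <<s>>%VS} -> lie_closed <<s>>%VS.
Proof.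
move=> sP x y xs ys.
rewrite (coord_span (X := in_tuple s) xs) (coord_span (X := in_tuple s) ys).
rewrite lie_suml; apply: memv_suml => i _; apply: memvZ; rewrite lie_sumr.
by apply: memv_suml => j _; apply: memvZ; apply: sP; apply: mem_nth.
Qed.

Lemma lieC (x y : L) : lie x y = - lie y x.
Proof.
have lD u v w : lie (u + v) w = lie u w + lie v w.
  by have := lieDZl 1 u v w; rewrite !scale1r.
have rD u v w : lie u (v + w) = lie u v + lie u w.
  by have := lieDZr 1 u v w; rewrite !scale1r.
apply/eqP; rewrite -addr_eq0; apply/eqP.
by have := liexx (x + y); rewrite lD !rD !liexx addr0 add0r.
Qed.

End Subalgebra.
Arguments subalg {F} L.

Definition subalg_type (F : fieldType) (L : lieAlgType F) (S : subalg L) : Type :=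
  subvs_of S.

Section SubalgebraType.
Variables (F : fieldType) (L : lieAlgType F) (S : subalg L).

HB.instance Definition _ := Vector.on (subalg_type S).

Definition sub_lie (x y : subalg_type S) : subalg_type S :=
  Subvs (subalg_closed (subvsP x) (subvsP y)).

Let sub_lieDZl (a : F) (x y z : subalg_type S) :
  sub_lie (a *: x + y) z = a *: sub_lie x z + sub_lie y z.
Proof. by apply: val_inj; rewrite /= lieDZl. Qed.

Let sub_lieDZr (a : F) (x y z : subalg_type S) :
  sub_lie x (a *: y + z) = a *: sub_lie x y + sub_lie x z.
Proof. by apply: val_inj; rewrite /= lieDZr. Qed.

Let sub_liexx (x : subalg_type S) : sub_lie x x = 0.
Proof. by apply: val_inj; rewrite /= liexx. Qed.

Let sub_lie_jacobi (x y z : subalg_type S) :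
  sub_lie x (sub_lie y z) + sub_lie y (sub_lie z x) + sub_lie z (sub_lie x y) = 0.
Proof. by apply: val_inj; rewrite /= lie_jacobi. Qed.

HB.instance Definition _ := Vector_isLieAlgebra.Build F (subalg_type S)
  sub_lieDZl sub_lieDZr sub_liexx sub_lie_jacobi.

End SubalgebraType.

Section MatrixLie.
Variables (F : fieldType) (n : nat).

Definition mx_lie (X Y : 'M[F]_n) : 'M[F]_n := X *m Y - Y *m X.

Let mx_lieDZl (a : F) (x y z : 'M[F]_n) :
  mx_lie (a *: x + y) z = a *: mx_lie x z + mx_lie y z.
Proof.
by rewrite /mx_lie mulmxDl mulmxDr -scalemxAl -scalemxAr scalerBr opprD addrACA.
Qed.

Let mx_lieDZr (a : F) (x y z : 'M[F]_n) :
  mx_lie x (a *: y + z) = a *: mx_lie x y + mx_lie x z.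
Proof.
by rewrite /mx_lie mulmxDl mulmxDr -scalemxAl -scalemxAr scalerBr opprD addrACA.
Qed.

Let mx_liexx (x : 'M[F]_n) : mx_lie x x = 0.
Proof. exact: subrr. Qed.

Let mx_lie_jacobi (x y z : 'M[F]_n) :
  mx_lie x (mx_lie y z) + mx_lie y (mx_lie z x) + mx_lie z (mx_lie x y) = 0.
Proof.
rewrite /mx_lie !mulmxBl !mulmxBr !mulmxA !opprB.
move: (x *m y *m z) (x *m z *m y) (y *m z *m x) (y *m x *m z) (z *m x *m y)
  (z *m y *m x) => a b c d e f.
by apply/matrixP=> i j; rewrite !mxE; ring.
Qed.

HB.instance Definition _ := Vector_isLieAlgebra.Build F 'M[F]_n
  mx_lieDZl mx_lieDZr mx_liexx mx_lie_jacobi.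

End MatrixLie.

Definition M8 (F : fieldType) : Type := 'rV[F]_4.

Section M8.
Variable F : fieldType.

HB.instance Definition _ := Vector.copy (M8 F) 'rV[F]_4.

(* Numbered from 0: [M8z i] is z_(i+1). *)
Definition M8z (i : 'I_4) : M8 F := delta_mx 0 i : 'rV[F]_4.

Definition M8_lie (u v : M8 F) : M8 F :=
  (u 0 0 * v 0 1 - u 0 1 * v 0 0) *: M8z 1 +
  (u 0 2 * v 0 3 - u 0 3 * v 0 2) *: M8z 3.

Let M8_lieDZl (a : F) (x y z : M8 F) :
  M8_lie (a *: x + y) z = a *: M8_lie x z + M8_lie y z.
Proof. by apply/rowP=> i; rewrite !mxE; ring. Qed.

Let M8_lieDZr (a : F) (x y z : M8 F) :
  M8_lie x (a *: y + z) = a *: M8_lie x y + M8_lie x z.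
Proof. by apply/rowP=> i; rewrite !mxE; ring. Qed.

Let M8_liexx (x : M8 F) : M8_lie x x = 0.
Proof. by apply/rowP=> i; rewrite !mxE; ring. Qed.

Let M8_lie_jacobi (x y z : M8 F) :
  M8_lie x (M8_lie y z) + M8_lie y (M8_lie z x) + M8_lie z (M8_lie x y) = 0.
Proof. by apply/rowP=> i; rewrite !mxE /=; ring. Qed.

HB.instance Definition _ := Vector_isLieAlgebra.Build F (M8 F)
  M8_lieDZl M8_lieDZr M8_liexx M8_lie_jacobi.

Lemma M8_lie_basis :
  [/\ lie (M8z 0) (M8z 1) = M8z 1, lie (M8z 2) (M8z 3) = M8z 3,
      lie (M8z 0) (M8z 2) = 0, lie (M8z 0) (M8z 3) = 0 &
      lie (M8z 1) (M8z 2) = 0 /\ lie (M8z 1) (M8z 3) = 0].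
Proof.
by do !split; apply/rowP=> i; rewrite /lie /= /M8_lie !mxE /=; ring.
Qed.

End M8.

Section SO4.
Context {F : fieldType}.
Definition so4 : {pred 'M[F]_(2 + 2)} :=
  [pred X | [&& ursubmx X == 0, dlsubmx X == 0,
                \tr (ulsubmx X) == 0 & \tr (drsubmx X) == 0]].

Lemma so4P (X : 'M[F]_(2 + 2)) :
  X \in so4 <-> exists A B : 'M[F]_2,
    [/\ \tr A = 0, \tr B = 0 & X = block_mx A 0 0 B].
Proof.
split=> [/and4P[/eqP a /eqP b /eqP c /eqP d] | [A [B [a b ->]]]].
  exists (ulsubmx X), (drsubmx X); split=> //.
  by rewrite -[LHS]submxK a b.
by rewrite inE /= block_mxKur block_mxKdl block_mxKul block_mxKdr a b !eqxx.
Qed.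

(* Matrix indices are numbered from 0. *)
Definition x1 : 'M[F]_(2 + 2) := delta_mx 0 1.
Definition h1 : 'M[F]_(2 + 2) := delta_mx 0 0 - delta_mx 1 1.
Definition x2 : 'M[F]_(2 + 2) := delta_mx 2 3.
Definition h2 : 'M[F]_(2 + 2) := delta_mx 2 2 - delta_mx 3 3.

Definition M81_space : {vspace 'M[F]_(2 + 2)} := <<[:: x1; x2; h1; h2]>>%VS.

Lemma M81_closed : lie_closed M81_space.
Proof.
have d2 (i j k l : 'I_4) :
    (delta_mx i j : 'M[F]_(2 + 2)) *m (delta_mx k l : 'M[F]_(2 + 2)) =
      delta_mx i l *+ (j == k) by exact: mul_delta_mx_cond.
have E u v : lie u v = u *m v - v *m u :> 'M[F]_(2 + 2) by [].
have x12 : lie x1 x2 = 0 by rewrite E !d2 /= subrr.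
have h12 : lie h1 h2 = 0.
  by rewrite E !mulmxBl !mulmxBr !d2 /= !subr0.
have h1x1 : lie h1 x1 = 2 *: x1.
  rewrite E mulmxBl mulmxBr !d2 /= !subr0 sub0r opprK.
  by rewrite -[2]/(1 + 1) scalerDl !scale1r.
have h1x2 : lie h1 x2 = 0 by rewrite E mulmxBl mulmxBr !d2 /= !subr0.
have h2x1 : lie h2 x1 = 0 by rewrite E mulmxBl mulmxBr !d2 /= !subr0.
have h2x2 : lie h2 x2 = 2 *: x2.
  rewrite E mulmxBl mulmxBr !d2 /= !subr0 sub0r opprK.
  by rewrite -[2]/(1 + 1) scalerDl !scale1r.
have x1M : x1 \in M81_space by apply: memv_span; rewrite !inE eqxx.
have x2M : x2 \in M81_space by apply: memv_span; rewrite !inE eqxx orbT.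
apply: lie_closed_span => u v.
by rewrite !inE => /or4P[] /eqP-> /or4P[] /eqP->;
  rewrite ?liexx ?x12 ?h12 ?h1x1 ?h1x2 ?h2x1 ?h2x2 ?mem0v ?memvZ //;
  rewrite lieC ?x12 ?h12 ?h1x1 ?h1x2 ?h2x1 ?h2x2 ?oppr0 ?mem0v //
    memvN memvZ.
Qed.

Definition M81 : subalg 'M[F]_(2 + 2) := Subalg M81_closed.

Definition conj_mx (P : 'M[F]_(2 + 2)) : 'End('M[F]_(2 + 2)) :=
  linfun (mulmxr (invmx P) \o mulmx P).

Lemma conj_mxE (P X : 'M[F]_(2 + 2)) : conj_mx P X = P *m X *m invmx P.
Proof. by rewrite lfunE. Qed.

Definition inner_equiv (S S' : {vspace 'M[F]_(2 + 2)}) : Prop :=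
  exists A B : 'M[F]_2, [/\ \det A = 1, \det B = 1 &
    (conj_mx (block_mx A 0 0 B) @: S)%VS = S'].

End SO4.
Arguments M81 F : clear implicits.

(* Main.v *)
(* The derived series of a subalgebra S consists of ideals of S.  Hence, if S is
   solvable and p is a homomorphism from S to sl_2 that is nonzero on S, the last
   derived term on which p is nonzero contains some z with p z <> 0 and
   [[p x, p z], p z] = 0 for all x in S.  Once p z is made upper triangular by
   conjugation in SL_2, these equations force every p x to be upper triangular.
   Applied to the two block projections, this conjugates S into M_8^1, and
   dim S = 4 gives equality. *)
From HB Require Import structures.
Require Import Defs.
From mathcomp Require Import all_boot all_order all_algebra.
From mathcomp Require Import reals complex ring.

Set Implicit Arguments.
Unset Strict Implicit.
Unset Printing Implicit Defensive.

Import GRing.Theory Num.Theory.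
Local Open Scope ring_scope.

(** * Derived series and images of solvable subalgebras *)

Section DerivedSeries.
Variables (F : fieldType) (L : lieAlgType F).
Implicit Type S : subalg L.

Lemma memv_lie_prod (U V : {vspace L}) x y :
  x \in U -> y \in V -> lie x y \in lie_prod U V.
Proof. by apply: (lie_prodP U V _).2. Qed.

Lemma derived_series_sub S n : (derived_series S n <= S)%VS.
Proof.
elim: n => [|n IHn] //=; apply/lie_prodP=> x y /(subvP IHn) xS /(subvP IHn) yS.
exact: Defs.subalg_closed xS yS.
Qed.

(** Induction on [n]: the Jacobi identity moves the bracket with [x] onto one factor of each
    generator of the next term. *)
Lemma derived_series_ideal S n x y :
  x \in subalg_space S -> y \in derived_series S n ->
  lie x y \in derived_series S n.
Proof.
elim: n x y => [|n IHn] x y xS yD /=; first exact: Defs.subalg_closed xS yD.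
rewrite (coord_span (X := in_tuple _) yD) lie_sumr.
apply: memv_suml => i _; apply: memvZ; set s := in_tuple _.
have /allpairsP[[u v] /= [/vbasis_mem uD /vbasis_mem vD ->]] : s`_i \in s.
  exact: mem_nth (ltn_ord i).
have /eqP := lie_jacobi x u v; rewrite -addrA addr_eq0 => /eqP ->.
rewrite memvN memvD // memv_lie_prod //; last exact: IHn.
by rewrite lieC memvN IHn.
Qed.

Lemma solvable_image_abelian_ideal (L' : lieAlgType F) (p : {linear L -> L'}) S :
  {in subalg_space S &, {morph p : x y / lie x y}} -> lie_solvable S ->
  {in subalg_space S, forall x, p x = 0} \/
  exists z, [/\ z \in subalg_space S, p z != 0 &
    {in subalg_space S, forall x, lie (lie (p x) (p z)) (p z) = 0}].
Proof.
move=> pM [n Dn0].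
have: {in derived_series S n, forall x, p x = 0}.
  by move=> x; rewrite Dn0 memv0 => /eqP ->; rewrite linear0.
elim: n {Dn0} => [|n IHn] pD0; first by left.
(* Testing [p] on a basis makes the case split decidable and supplies [z]. *)
have [/allP pb0 | /allPn[z /vbasis_mem zD pz0]] :=
    boolP (all (fun z => p z == 0) (vbasis (derived_series S n))).
  apply: IHn => x /coord_vbasis ->; rewrite linear_sum big1 // => i _.
  set b := vbasis _ in pb0 *; have /pb0/eqP pb : b`_i \in b.
    by rewrite mem_nth ?size_tuple.
  by rewrite linearZ pb; exact: scaler0.
right; exists z; have zS := subvP (derived_series_sub S n) z zD.
split=> // x xS; have xzD := derived_series_ideal xS zD.
(* Both [x, z] and [z] lie in the [n]th term, so [[x, z], z] lies in the next one, where [p]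
   vanishes. *)
rewrite -!pM ?pD0 //; first exact: memv_lie_prod.
exact: Defs.subalg_closed xS zS.
Qed.

End DerivedSeries.

(** * Two by two matrices and trigonalization in sl_2 *)

Lemma ord2P (i : 'I_2) : i = 0 \/ i = 1.
Proof. by case: i => [[|[|]]] // ?; [left|right]; apply: val_inj. Qed.

Lemma mxtrace2 (R : comPzRingType) (A : 'M[R]_2) : \tr A = A 0 0 + A 1 1.
Proof.
rewrite /mxtrace !big_ord_recl big_ord0 addr0.
by congr (_ + A _ _); apply: val_inj.
Qed.

Lemma det2 (R : comPzRingType) (A : 'M[R]_2) :
  \det A = A 0 0 * A 1 1 - A 0 1 * A 1 0.
Proof.
rewrite (expand_det_row _ 0) !big_ord_recl big_ord0 addr0 /cofactor !det_mx11.
rewrite !mxE !expr0 !expr1 !mul1r mulN1r mulrN.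
by congr (_ * A _ _ - A _ _ * A _ _); apply: val_inj.
Qed.

Lemma mulmx2 (R : comPzRingType) (A B : 'M[R]_2) i j :
  (A *m B) i j = A i 0 * B 0 j + A i 1 * B 1 j.
Proof.
rewrite mxE !big_ord_recl big_ord0 addr0.
by congr (_ + A _ _ * B _ _); apply: val_inj.
Qed.

Lemma sl2_trigonalizable (C : numClosedFieldType) (Z : 'M[C]_2) : \tr Z = 0 ->
  exists A : 'M[C]_2, \det A = 1 /\ (A *m Z *m invmx A) 1 0 = 0.
Proof.
move=> /eqP; rewrite mxtrace2 addrC addr_eq0 => /eqP Z11.
have [Z10|Z10] := eqVneq (Z 1 0) 0.
  by exists 1%:M; rewrite det1 invmx1 mulmx1 mul1mx.
(* Trace zero gives det Z = - l^2, so [l] is an eigenvalue of [Z]. *)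
pose l := sqrtC (Z 0 0 ^+ 2 + Z 0 1 * Z 1 0).
have l2 : l ^+ 2 = Z 0 0 ^+ 2 + Z 0 1 * Z 1 0 by exact: sqrtCK.
(* The second row of [A] is a left eigenvector of [Z] with eigenvalue [l]. *)
pose A : 'M[C]_2 := \matrix_(i, j)
  if i == 0 then (if j == 0 then 0 else - (Z 1 0)^-1)
  else (if j == 0 then Z 1 0 else l - Z 0 0).
(* The first row (0, - 1 / Z 1 0) is chosen to make the determinant 1. *)
have detA : \det A = 1.
  by rewrite det2 !mxE /= mul0r sub0r mulNr opprK mulVf.
have uA : A \in unitmx by rewrite unitmxE detA unitr1.
exists A; split=> //.
have eigA : row 1 (A *m Z) = l *: row 1 A.
  apply/rowP=> j; rewrite [LHS]mxE mulmx2 !mxE /=.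
  have [->|->] := ord2P j.
    by rewrite /=; ring.
  by rewrite /= Z11; ring: l2.
(* Row 1 of the conjugate is [l] times row 1 of the identity, so its entry 0 vanishes. *)
have := congr1 (fun v => (v *m invmx A) 0 0) eigA.
by rewrite /= -row_mul -scalemxAl -row_mul mulmxV // !mxE mulr0.
Qed.

Lemma lie_mx2 (F : fieldType) (X Y : 'M[F]_2) i j : lie X Y i j =
  X i 0 * Y 0 j + X i 1 * Y 1 j - (Y i 0 * X 0 j + Y i 1 * X 1 j).
Proof. by rewrite -!mulmx2 [LHS]mxE [X in _ + X]mxE. Qed.

(* An upper triangular nonzero [Z] of trace 0 has either a nonzero diagonal or
   only the entry [Z 0 1]; the entry 1 0, resp. 0 1, of [[X, Z], Z] is then a
   nonzero multiple of [X 1 0]. *)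
Lemma sl2_entry10_eq0 (F : fieldType) (X Z : 'M[F]_2) : 2 != 0 :> F ->
  \tr X = 0 -> \tr Z = 0 -> Z != 0 -> Z 1 0 = 0 ->
  lie (lie X Z) Z = 0 -> X 1 0 = 0.
Proof.
rewrite !mxtrace2 => n2 /eqP; rewrite addrC addr_eq0 => /eqP X11 /eqP.
rewrite addrC addr_eq0 => /eqP Z11 Z0 Z10 XZ0.
have E i j : lie (lie X Z) Z i j = 0 by rewrite XZ0 mxE.
have n4 : 4 != 0 :> F by rewrite (natrM _ 2 2) mulf_neq0.
apply/eqP; have [Z00|Z00] := eqVneq (Z 0 0) 0; last first.
  (* As [Z] is upper triangular of trace 0, each bracket with [Z] on the right multiplies the entry
     1 0 by [2 * Z 0 0]. *)
  have -> : X 1 0 = (4 * Z 0 0 ^+ 2)^-1 * lie (lie X Z) Z 1 0.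
    by rewrite !lie_mx2 Z10 Z11; field; rewrite Z00 n4.
  by rewrite E mulr0.
have Z01 : Z 0 1 != 0.
  apply: contraNneq Z0 => Z01; apply/eqP/matrixP=> i j; rewrite mxE.
  by case: (ord2P i) => ->; case: (ord2P j) => ->; rewrite ?Z11 ?Z00 ?oppr0.
(* Now Z^2 = 0, so [[X, Z], Z] = - 2 Z X Z, whose entry 0 1 is - 2 (Z 0 1)^2 (X 1 0). *)
have -> : X 1 0 = - (2 * Z 0 1 ^+ 2)^-1 * lie (lie X Z) Z 0 1.
  by rewrite !lie_mx2 Z10 Z11 Z00; field; rewrite Z01 n2.
by rewrite E mulr0.
Qed.

Lemma lie_conj (F : fieldType) n (A X Y : 'M[F]_n) : A \in unitmx ->
  lie (A *m X *m invmx A) (A *m Y *m invmx A) = A *m lie X Y *m invmx A.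
Proof.
move=> uA; rewrite /lie /= /mx_lie mulmxBr mulmxBl !mulmxA.
by rewrite !mulmxKV.
Qed.

Lemma mxtrace_conj (F : fieldType) n (A X : 'M[F]_n) : A \in unitmx ->
  \tr (A *m X *m invmx A) = \tr X.
Proof. by move=> uA; rewrite mxtrace_mulC mulmxA mulVmx ?mul1mx. Qed.

(** Only [p z] is trigonalized; the same [A] serves every [x] because traces, nonvanishing and
    brackets survive conjugation. *)
Lemma sl2_solvable_image_trigonalizable (C : numClosedFieldType) (L : lieAlgType C)
    (p : {linear L -> 'M[C]_2}) (S : subalg L) :
  {in subalg_space S &, {morph p : x y / lie x y}} ->
  {in subalg_space S, forall x, \tr (p x) = 0} -> lie_solvable S ->
  exists A : 'M[C]_2, \det A = 1 /\
    {in subalg_space S, forall x, (A *m p x *m invmx A) 1 0 = 0}.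
Proof.
move=> pM ptr0 /(solvable_image_abelian_ideal pM)[p0|[z [zS pz0 pzab]]].
  by exists 1%:M; rewrite det1; split=> // x xS; rewrite p0 // mulmx0 mul0mx mxE.
have [A [detA Az]] := sl2_trigonalizable (ptr0 z zS).
have uA : A \in unitmx by rewrite unitmxE detA unitr1.
exists A; split=> // x xS.
apply: (@sl2_entry10_eq0 _ _ (A *m p z *m invmx A));
  rewrite ?pnatr_eq0 ?mxtrace_conj ?ptr0 //.
  apply: contraNneq pz0 => Az0.
  by rewrite -[p z](mulKmx uA) -[A *m p z](mulmxKV uA) Az0 mul0mx mulmx0.
by rewrite !lie_conj // pzab // mulmx0 mul0mx.
Qed.

(** * Block projections of so(4) and coordinates on M_8^1 *)

Lemma so4_ulsubmx_lie (F : fieldType) (X Y : 'M[F]_(2 + 2)) :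
  X \in so4 -> Y \in so4 -> ulsubmx (lie X Y) = lie (ulsubmx X) (ulsubmx Y).
Proof.
move=> /so4P[A [B [_ _ ->]]] /so4P[A' [B' [_ _ ->]]].
rewrite [lie (block_mx _ _ _ _) _]/lie /= /mx_lie !mulmx_block opp_block_mx.
by rewrite add_block_mx !block_mxKul !mulmx0 !addr0.
Qed.

Lemma so4_drsubmx_lie (F : fieldType) (X Y : 'M[F]_(2 + 2)) :
  X \in so4 -> Y \in so4 -> drsubmx (lie X Y) = lie (drsubmx X) (drsubmx Y).
Proof.
move=> /so4P[A [B [_ _ ->]]] /so4P[A' [B' [_ _ ->]]].
rewrite [lie (block_mx _ _ _ _) _]/lie /= /mx_lie !mulmx_block opp_block_mx.
by rewrite add_block_mx !block_mxKdr !mulmx0 !add0r.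
Qed.

Lemma ord4P (i : 'I_(2 + 2)) :
  [\/ i = lshift 2 0, i = lshift 2 1, i = rshift 2 0 | i = rshift 2 1].
Proof.
case: (split_ordP i) => k ->; case: (ord2P k) => ->.
- by constructor 1.
- by constructor 2.
- by constructor 3.
- by constructor 4.
Qed.

(** Coordinates in the spanning family are matrix entries, which turns membership into an entrywise
    computation. *)
Lemma M81E (F : fieldType) (X : 'M[F]_(2 + 2)) : (X \in M81_space) =
  (X == ulsubmx X 0 1 *: x1 + drsubmx X 0 1 *: x2 +
        ulsubmx X 0 0 *: h1 + drsubmx X 0 0 *: h2).
Proof.
apply/idP/eqP=> [/(coord_span (X := in_tuple _)) XE | ->]; last first.
  by rewrite !memvD ?memvZ ?memv_span // !inE eqxx ?orbT.
have {XE}[a [b [c [d ->]]]] :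
    exists a b c d, X = a *: x1 + b *: x2 + c *: h1 + d *: h2.
  rewrite XE !big_ord_recl big_ord0 addr0 /= !addrA.
  by do 4!eexists.
by congr (_ *: _ + _ *: _ + _ *: _ + _ *: _); rewrite !mxE /=; ring.
Qed.

(** M_8^1 is the product of the upper triangular Borel subalgebras of the two sl_2 blocks. *)
Lemma so4_M81 (F : fieldType) (X : 'M[F]_(2 + 2)) : X \in so4 ->
  ulsubmx X 1 0 = 0 -> drsubmx X 1 0 = 0 -> X \in M81_space.
Proof.
move=> /so4P[A [B [/eqP + /eqP + ->]]]; rewrite block_mxKul block_mxKdr.
rewrite !mxtrace2 ![_ 0 0 + _]addrC !addr_eq0 => /eqP A11 /eqP B11 A10 B10.
rewrite M81E; apply/eqP; rewrite block_mxKul block_mxKdr.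
apply/matrixP=> i j; case: (ord4P i) => ->; case: (ord4P j) => ->;
  rewrite ?block_mxEul ?block_mxEur ?block_mxEdl ?block_mxEdr !mxE /=
    ?A11 ?B11 ?A10 ?B10; ring.
Qed.

Lemma M81_sub_so4 (F : fieldType) : {subset M81 F <= so4}.
Proof.
move=> X; rewrite [X \in _]M81E => /eqP ->.
apply/and4P; split; rewrite ?mxtrace2; apply/eqP.
- apply/matrixP=> i j; case: (ord2P i) => ->; case: (ord2P j) => ->;
    by rewrite !mxE /=; ring.
- apply/matrixP=> i j; case: (ord2P i) => ->; case: (ord2P j) => ->;
    by rewrite !mxE /=; ring.
- by rewrite !mxE /=; ring.
- by rewrite !mxE /=; ring.
Qed.

Lemma dim_M81 (F : fieldType) : \dim (M81 F) = 4%N.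
Proof.
(* [free] is by definition the equality of the dimension of the span with the length 4. *)
apply/eqP; suff: free [:: x1; x2; h1; h2 : 'M[F]_(2 + 2)] by [].
apply/(@freeP _ _ _ (in_tuple _)) => k.
rewrite !big_ord_recl big_ord0 addr0 /= => /matrixP sum0 i.
(* Each of these entries is nonzero in exactly one of the four matrices. *)
have := (sum0 0 1, sum0 2 3, sum0 0 0, sum0 2 2).
rewrite !mxE /= !(oppr0, mulr1, mulr0, addr0, add0r).
case=> [[[k0 k1] k2] k3]; case: i => [[|[|[|[|]]]]] // pi.
- by rewrite -[RHS]k0; congr k; apply: val_inj.
- by rewrite -[RHS]k1; congr k; apply: val_inj.
- by rewrite -[RHS]k2; congr k; apply: val_inj.
- by rewrite -[RHS]k3; congr k; apply: val_inj.
Qed.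

Lemma M81_entries (F : fieldType) (X : 'M[F]_(2 + 2)) : X \in M81_space ->
  [/\ ulsubmx X 1 0 = 0, drsubmx X 1 0 = 0,
      ulsubmx X 1 1 = - ulsubmx X 0 0 & drsubmx X 1 1 = - drsubmx X 0 0].
Proof. by rewrite M81E => /eqP ->; split; rewrite !mxE /=; ring. Qed.

(** The zero diagonals give solvability; the entries 0 1 are compared with the bracket of M_8. *)
Lemma M81_lie_entries (F : fieldType) (X Y : 'M[F]_(2 + 2)) :
  X \in M81_space -> Y \in M81_space ->
  let a := @ulsubmx F 2 2 2 2 in let b := @drsubmx F 2 2 2 2 in
  [/\ a (lie X Y) 0 0 = 0, b (lie X Y) 0 0 = 0,
      a (lie X Y) 0 1 = 2 * (a X 0 0 * a Y 0 1 - a X 0 1 * a Y 0 0) &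
      b (lie X Y) 0 1 = 2 * (b X 0 0 * b Y 0 1 - b X 0 1 * b Y 0 0)].
Proof.
move=> XM YM /=; have [X1 X2 X3 X4] := M81_entries XM.
have [Y1 Y2 Y3 Y4] := M81_entries YM.
rewrite so4_ulsubmx_lie ?so4_drsubmx_lie ?(@M81_sub_so4 F) // !lie_mx2.
by rewrite X1 X2 X3 X4 Y1 Y2 Y3 Y4; split; ring.
Qed.

(** All brackets fall into the span of [x1] and [x2], which is abelian, so the second derived term
    is zero. *)
Lemma M81_solvable (F : fieldType) : lie_solvable (M81 F).
Proof.
pose N : {vspace 'M[F]_(2 + 2)} := <<[:: x1; x2]>>%VS.
have NP X : X \in N ->
    [/\ X \in M81_space, ulsubmx X 0 0 = 0 & drsubmx X 0 0 = 0].
  move=> /(coord_span (X := in_tuple _)) ->.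
  rewrite !big_ord_recl big_ord0 addr0 /=; split.
  - by rewrite memvD ?memvZ ?memv_span // !inE eqxx ?orbT.
  - by rewrite !mxE /=; ring.
  - by rewrite !mxE /=; ring.
have sN : (lie_prod (M81 F) (M81 F) <= N)%VS.
  apply/lie_prodP=> X Y XM YM; have XYM := M81_closed XM YM.
  have [e1 e2 _ _] := M81_lie_entries XM YM.
  move: XYM; rewrite M81E e1 e2 !scale0r !addr0 => /eqP ->.
  by rewrite memvD ?memvZ ?memv_span // !inE eqxx ?orbT.
exists 2; apply/eqP; rewrite -subv0 /=; apply/lie_prodP=> X Y.
move=> /(subvP sN)/NP[XM X1 X2] /(subvP sN)/NP[YM Y1 Y2].
have [e1 e2 e3 e4] := M81_lie_entries XM YM.
have := M81_closed XM YM.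
rewrite M81E e1 e2 e3 e4 X1 X2 Y1 Y2 !(mul0r, mulr0, subrr, scale0r, addr0).
by rewrite memv0.
Qed.

(** * The isomorphism of M_8^1 with M_8 *)

Section M81IsoM8.
Variable F : fieldType.

(* [h_i / 2] plays the role of [z_1], [z_3], and [x_i] that of [z_2], [z_4]. *)
Definition M81_to_M8 (X : subalg_type (M81 F)) : M8 F :=
  (2 * ulsubmx (vsval X) 0 0) *: M8z F 0 + ulsubmx (vsval X) 0 1 *: M8z F 1 +
  ((2 * drsubmx (vsval X) 0 0) *: M8z F 2 + drsubmx (vsval X) 0 1 *: M8z F 3).

Let M81_to_M8_linear : linear M81_to_M8.
Proof. by move=> a X Y; apply/rowP=> i; rewrite !mxE; ring. Qed.

HB.instance Definition _ :=
  GRing.isLinear.Build F (subalg_type (M81 F)) (M8 F) *:%R M81_to_M8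
    M81_to_M8_linear.

Lemma M81_iso_M8 : 2 != 0 :> F -> lie_isomorphic (subalg_type (M81 F)) (M8 F).
Proof.
move=> n2; exists M81_to_M8; split.
  (* The inverse halves the diagonal coordinates, hence the hypothesis on 2. *)
  pose g (v : M8 F) : 'M[F]_(2 + 2) :=
    v 0 1 *: x1 + v 0 3 *: x2 + (v 0 0 / 2) *: h1 + (v 0 2 / 2) *: h2.
  have gM v : g v \in M81_space.
    by rewrite !memvD ?memvZ ?memv_span // !inE eqxx ?orbT.
  exists (fun v => Subvs (gM v)) => [X | v].
    apply: val_inj; rewrite /= /g; have := subvsP X.
    rewrite [_ \in _]M81E => /eqP XE.
    rewrite [RHS]XE; congr (_ *: _ + _ *: _ + _ *: _ + _ *: _);
      by rewrite !mxE /=; field.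
  apply/rowP=> i; rewrite !mxE /=.
  have [->|->|->|->] : [\/ i = 0, i = 1, i = 2 | i = 3].
    case: i => [[|[|[|[|]]]]] // pi.
    - by constructor 1; apply: val_inj.
    - by constructor 2; apply: val_inj.
    - by constructor 3; apply: val_inj.
    - by constructor 4; apply: val_inj.
  - by rewrite /=; field.
  - by rewrite /=; field.
  - by rewrite /=; field.
  - by rewrite /=; field.
(* The factor 2 in the entries 0 1 of a bracket is absorbed by the doubled diagonal coordinates. *)
move=> X Y; have [e1 e2 e3 e4] := M81_lie_entries (subvsP X) (subvsP Y).
have vlie : vsval (lie X Y) = lie (vsval X) (vsval Y) by [].
rewrite /= /M81_to_M8 vlie e1 e2 e3 e4 /lie /= /M8_lie.
by apply/rowP=> i; rewrite !mxE /=; ring.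
Qed.

End M81IsoM8.

(** * Uniqueness up to inner automorphism *)

Theorem theorem5p9 (R : realType) :
  [/\ {subset M81 R[i] <= so4},
      \dim (M81 R[i]) = 4%N,
      lie_solvable (M81 R[i]),
      forall S : subalg 'M[R[i]]_(2 + 2),
        {subset S <= so4} -> \dim S = 4%N -> lie_solvable S ->
        inner_equiv S (M81 R[i]) &
      lie_isomorphic (subalg_type (M81 R[i])) (M8 R[i])].
Proof.
split;
  [exact: M81_sub_so4 | exact: dim_M81 | exact: M81_solvable | |]; last first.
  by apply: M81_iso_M8; rewrite pnatr_eq0.
move=> S Sso dimS solS.
have [A [detA Aup]] : exists A : 'M[R[i]]_2, \det A = 1 /\
    {in subalg_space S, forall X, (A *m ulsubmx X *m invmx A) 1 0 = 0}.
  (* The composite unfolds to [ulsubmx] and is linear as a composite of linear maps. *)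
  apply: (sl2_solvable_image_trigonalizable (p := lsubmx \o usubmx)) => //.
    by move=> X Y /Sso XS /Sso YS; apply: so4_ulsubmx_lie.
  by move=> X /Sso/and4P[_ _ /eqP].
have [B [detB Bup]] : exists B : 'M[R[i]]_2, \det B = 1 /\
    {in subalg_space S, forall X, (B *m drsubmx X *m invmx B) 1 0 = 0}.
  apply: (sl2_solvable_image_trigonalizable (p := rsubmx \o dsubmx)) => //.
    by move=> X Y /Sso XS /Sso YS; apply: so4_drsubmx_lie.
  by move=> X /Sso/and4P[_ _ _ /eqP].
exists A, B; split=> //; apply/eqP.
have uA : A \in unitmx by rewrite unitmxE detA unitr1.
have uB : B \in unitmx by rewrite unitmxE detB unitr1.
have uAB : block_mx A 0 0 B \in unitmx by rewrite block_diag_mx_unit uA.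
(* Inclusion of the conjugate in M_8^1 and a dimension count give equality. *)
rewrite eqEdim; apply/andP; split.
  apply/subvP=> _ /memv_imgP[X XS ->]; rewrite conj_mxE invmx_block_diag //.
  move: (Aup X XS) (Bup X XS); have /so4P[A' [B' [trA' trB' ->]]] := Sso X XS.
  rewrite block_mxKul block_mxKdr !mulmx_block !(mulmx0, mul0mx, addr0, add0r).
  move=> A10 B10; apply: so4_M81; rewrite ?block_mxKul ?block_mxKdr //.
  by apply/so4P; do 2!eexists; split; last by []; rewrite mxtrace_conj.
(* Conjugation is injective, so the image of [S] still has dimension 4. *)
rewrite limg_dim_eq ?dimS ?dim_M81 //; apply/eqP; rewrite -subv0.
apply: subv_trans (capvSr _ _) _; rewrite subv0; apply/lker0P=> X Y.
rewrite !conj_mxE => XY; apply: (can_inj (mulKmx uAB)).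
by apply: can_inj (mulmxK _) _ _ XY; rewrite unitmx_inv.
Qed.
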